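(* Let $p$ be a prime and let $A\subseteq\mathbb{F}_p$ satisfy $A-A\doteq\mathcal{R}_p$ (so in particular $p\equiv1\pmod 4$). Then the multiplier subgroup $M_A$ contains the unique subgroup of $\mathbb{F}_p^\times$ of order $G_p$; equivalently, $G_p$ divides $|M_A|$.
   Context: $\mathcal{R}_p$ is the set of nonzero quadratic residues modulo $p$. $A-A\doteq S$ means: every element of $S$ has exactly one representation as $a'-a''$ with $a',a''\in A$, and every difference $a'-a''$ with $a'\ne a''$ in $A$ lies in $S$. An element $\mu\in\mathbb{F}_p^\times$ is a multiplier of $A\subseteq\mathbb{F}_p$ if there is $g\in\mathbb{F}_p$ with $\mu A=A+g$, where $\mu A=\{\mu a\colon a\in A\}$; the multipliers of $A$ form a subgroup $M_A$ of $\mathbb{F}_p^\times$ (the multiplier subgroup). For a prime $p\equiv1\pmod4$, $G_p:=\gcd\{\operatorname{ord}_p(q)\colon q \text{ prime},\ q\mid \tfrac{p-1}{4}\}$, where $\operatorname{ord}_p(q)$ is the multiplicative order of $q$ modulo $p$.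
   Formalization: For p=5 the number (p-1)/4=1 has no prime divisor, so G_5 is a gcd over the empty set (0 or undefined) and the claim fails for A={0,1}; here G_5 is taken to be 1. The parenthetical consequence p≡1 (mod 4) is not stated separately. *)

(* Defs.v *)
From HB Require Import structures.
From mathcomp Require Import all_boot all_order all_algebra.
Set Implicit Arguments. Unset Strict Implicit. Unset Printing Implicit Defensive.
Import GRing.Theory.
Local Open Scope ring_scope.

Definition QR (p : nat) : {set 'F_p} :=
  [set x : 'F_p | (x != 0) && [exists y : 'F_p, y ^+ 2 == x]].

Definition diff_exact (p : nat) (A S : {set 'F_p}) : Prop :=
  (forall s, s \in S -> #|[set u in setX A A | u.1 - u.2 == s]| = 1%N) /\
  (forall a1 a2, a1 \in A -> a2 \in A -> a1 != a2 -> a1 - a2 \in S).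

Definition is_multiplier (p : nat) (A : {set 'F_p}) (mu : 'F_p) : Prop :=
  mu != 0 /\ exists g : 'F_p, [set mu * a | a in A] = [set a + g | a in A].

Definition mult_set (p : nat) (A : {set 'F_p}) : {set 'F_p} :=
  [set mu : 'F_p | (mu != 0) &&
     [exists g : 'F_p, [set mu * a | a in A] == [set a + g | a in A]]].

(* ord_p(q): the least k >= 1 with q^k = 1 (mod p) (0 if none exists) *)
Definition ordp (p q : nat) : nat :=
  head 0%N [seq k <- iota 1 p.-1 | (q ^ k %% p == 1 %% p)%N].

(* G_p = gcd { ord_p(q) : q prime, q | (p-1)/4 }.
   Convention: when there is no such prime (p = 5) we set G_p = 1. *)
Definition Gp (p : nat) : nat :=
  let qs := primes ((p.-1) %/ 4) in
  if qs is [::] then 1%N else foldr gcdn 0%N [seq ordp p q | q <- qs].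

(* Main.v *)
(** Write a(k) for the sum of zeta^(k x) over x in A, zeta a primitive p-th root of
unity, m = (p - 1) / 4, and let alpha, alpha' = |A| + (-1 +- sqrt p) / 2 be the two
values of a(k) a(-k) for k <> 0.  Then alpha alpha' = m, so only primes above a
prime divisor q of m divide a(1).  If mu is a power of every such q modulo p, the
automorphism sigma : zeta |-> zeta^mu acts as a power of Frobenius modulo q and
fixes these (unramified) primes, so a(mu) = u a(1) with u in Z[zeta].  For m > 1
the ideals (alpha) and (alpha') differ, hence mu is a quadratic residue and u
has absolute value 1 at every embedding; so u = +- zeta^g, and Fourier inversion
turns a(mu k) = +- zeta^(g k) a(k) into mu A = A + g.

Ideal factorisation is avoided: sigma X \in (X, m) is proved directly for all X in
Z[zeta] by induction on m, and m = a(1) a(-1) alpha' is a multiple of a(1). *)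

Require Import Defs.
From HB Require Import structures.
From mathcomp Require Import all_boot all_order all_fingroup all_algebra all_solvable all_field.
From mathcomp Require Import ring zify.
Import Order.TTheory GRing.Theory Num.Theory.
Local Open Scope ring_scope.
Set Implicit Arguments. Unset Strict Implicit. Unset Printing Implicit Defensive.

(** * Congruences modulo an integer inside a subring *)

Section SubringCongruence.
Variables (R : comNzRingType) (S : R -> Prop).
Hypothesis S1 : S 1.
Hypothesis SB : forall x y, S x -> S y -> S (x - y).
Hypothesis SM : forall x y, S x -> S y -> S (x * y).

(** The quotient must be required to lie in [S]: the ambient ring will be the field [algC], where
    divisibility by [d] alone says nothing. *)
Definition eqmodS (d : nat) (x y : R) := exists2 z, S z & x - y = d%:R * z.

Lemma closed0 : S 0. Proof. by rewrite -(subrr 1); apply: SB. Qed.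

Lemma closedN x : S x -> S (- x).
Proof. by move=> Sx; rewrite -sub0r; apply: SB => //; apply: closed0. Qed.

Lemma closedD x y : S x -> S y -> S (x + y).
Proof. by move=> Sx Sy; rewrite -[y]opprK; apply: SB => //; apply: closedN. Qed.

Lemma closedX x n : S x -> S (x ^+ n).
Proof. by move=> Sx; elim: n => [|n IH]; rewrite ?expr0 // exprS; apply: SM. Qed.

Lemma closed_sum (I : Type) (r : seq I) (P : pred I) (G : I -> R) :
  (forall i, P i -> S (G i)) -> S (\sum_(i <- r | P i) G i).
Proof. by move=> SG; elim/big_ind: _ => //; [apply: closed0 | apply: closedD]. Qed.

Lemma closed_nat n : S n%:R.
Proof. by elim: n => [|n IH]; [apply: closed0 | rewrite -addn1 natrD; apply: closedD]. Qed.

Lemma closed_int (z : int) : S z%:~R.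
Proof. by case: z => n; rewrite ?NegzE ?mulrNz; [|apply: closedN]; apply: closed_nat. Qed.

Lemma eqmodS_refl d x : eqmodS d x x.
Proof. by exists 0; [apply: closed0 | rewrite subrr mulr0]. Qed.

Lemma eqmodS_trans d y x z : eqmodS d x y -> eqmodS d y z -> eqmodS d x z.
Proof.
move=> [u Su xy] [v Sv yz]; exists (u + v); first exact: closedD.
by rewrite mulrDr -xy -yz; ring.
Qed.

Lemma eqmodS_sym d x y : eqmodS d x y -> eqmodS d y x.
Proof. by move=> [u Su xy]; exists (- u); [apply: closedN | rewrite mulrN -xy opprB]. Qed.

Lemma eqmodS_add d x y x' y' :
  eqmodS d x y -> eqmodS d x' y' -> eqmodS d (x + x') (y + y').
Proof.
move=> [u Su xy] [v Sv xy']; exists (u + v); first exact: closedD.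
by rewrite mulrDr -xy -xy'; ring.
Qed.

Lemma eqmodS_sum d (I : Type) (r : seq I) (G H : I -> R) :
  (forall i, eqmodS d (G i) (H i)) ->
  eqmodS d (\sum_(i <- r) G i) (\sum_(i <- r) H i).
Proof.
move=> GH; elim: r => [|i r IH]; first by rewrite !big_nil; apply: eqmodS_refl.
by rewrite !big_cons; apply: eqmodS_add.
Qed.

Lemma eqmodS_mulr d z x y : S z -> eqmodS d x y -> eqmodS d (x * z) (y * z).
Proof.
move=> Sz [u Su xy]; exists (u * z); first exact: SM.
by rewrite mulrA -xy; ring.
Qed.

Lemma eqmodS_exp d n x y : S x -> S y -> eqmodS d x y -> eqmodS d (x ^+ n) (y ^+ n).
Proof.
move=> Sx Sy xy; elim: n => [|n IH]; first by rewrite !expr0; apply: eqmodS_refl.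
rewrite !exprS; apply: (@eqmodS_trans _ (y * x ^+ n)).
  by apply: eqmodS_mulr => //; apply: closedX.
by rewrite ![y * _]mulrC; apply: eqmodS_mulr.
Qed.

Lemma eqmodS_expD q x y : prime q -> S x -> S y ->
  eqmodS q ((x + y) ^+ q) (x ^+ q + y ^+ q).
Proof.
move=> q_pr Sx Sy; case: q q_pr => [|[|q]] // q_pr.
rewrite exprDn big_ord_recl big_ord_recr /= bin0 binn !mulr1n subn0 subnn !expr0 mulr1 mul1r.
rewrite addrCA addrC /bump /=.
set s := \sum_(i < q.+1) _.
exists (\sum_(i < q.+1) (x ^+ (q.+2 - (1 + i)) * y ^+ (1 + i)) * ('C(q.+2, 1 + i) %/ q.+2)%:R).
  by apply: closed_sum => i _; apply: SM; [apply: SM; apply: closedX | apply: closed_nat].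
rewrite mulr_sumr; transitivity s; first by ring.
apply: eq_bigr => i _; rewrite mulrCA -natrM mulnC divnK ?mulr_natr //.
by apply: prime_dvd_bin => //=; have := ltn_ord i; lia.
Qed.

Lemma eqmodS_exp_sum q (I : Type) (r : seq I) (G : I -> R) :
  prime q -> (forall i, S (G i)) ->
  eqmodS q ((\sum_(i <- r) G i) ^+ q) (\sum_(i <- r) G i ^+ q).
Proof.
move=> q_pr SG; elim: r => [|i r IH].
  by rewrite !big_nil expr0n gtn_eqF ?prime_gt0 //; apply: eqmodS_refl.
rewrite !big_cons; apply: eqmodS_trans (eqmodS_expD q_pr (SG i) _) _.
  by apply: closed_sum => j _.
by apply: eqmodS_add => //; apply: eqmodS_refl.
Qed.

Lemma eqmodS_fermat q (z : int) : prime q -> eqmodS q (z%:~R ^+ q) z%:~R.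
Proof.
move=> q_pr; have: (q %| z ^+ q - z)%Z.
  rewrite (dvdz_pcharf (pchar_Fp q_pr)) rmorphB rmorphXn /=.
  by rewrite -[X in _ ^+ X](card_Fp q_pr) expf_card subrr.
case/dvdzP=> w zw; exists w%:~R; first exact: closed_int.
by rewrite -rmorphXn -rmorphB /= zw rmorphM mulrC.
Qed.

(* Locally at a prime above q, the hypotheses say that q is unramified and that
   f does not decrease valuations; the conclusion is f X \in (X, d). *)
Lemma rmorph_in_ideal (f : {rmorphism R -> R}) (d : nat) :
  (forall x, S x -> S (f x)) -> (0 < d)%N ->
  (forall q, prime q -> (q %| d)%N ->
     (exists n, forall X, S X -> eqmodS q X (X ^+ n.+2)) /\
     (forall X, S X -> exists n, eqmodS q (f X) (X ^+ n.+1))) ->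
  forall X, S X -> exists V W, [/\ S V, S W & f X = X * V + d%:R * W].
Proof.
move=> Sf; have [n] := ubnP d; elim: n d => // n IH d d_lt d_gt0 Hd X SX0.
have [d1|d_gt1] := leqP d 1.
  have ->: d = 1%N by lia.
  by exists 0, (f X); split; [apply: closed0 | apply: Sf | rewrite mulr0 mul1r add0r].
set q := pdiv d; have q_pr : prime q by apply: pdiv_prime.
have q_d : (q %| d)%N by apply: pdiv_dvd.
pose d' := (d %/ q)%N; have dE : d = (q * d')%N by rewrite mulnC divnK.
have d'_lt : (d' < n)%N.
  by apply: leq_trans (ltn_Pdiv (prime_gt1 q_pr) d_gt0) _; rewrite -ltnS.
have d'_gt0 : (0 < d')%N by rewrite divn_gt0 ?prime_gt0 // dvdn_leq.
have {}IH := IH d' d'_lt d'_gt0 _.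
(* The induction hypothesis for d' = d / q is used twice: for [X], and below for [Z], the quotient
   of X - X^(N+2) by q. *)
have [|V2 [W2 [SV2 SW2 x2]]] := IH _ X SX0.
  by move=> r r_pr rd; apply: Hd => //; rewrite dE dvdn_mull.
have [[N HN] /(_ X SX0) [i [W1 SW1 x1]]] := Hd q q_pr q_d.
have [Z SZ XZ] := HN X SX0.
have [|V' [W' [SV' SW' fZ]]] := IH _ Z SZ.
  by move=> r r_pr rd; apply: Hd => //; rewrite dE dvdn_mull.
have x1' : f X = X * X ^+ i + q%:R * W1 by rewrite -x1 exprS; ring.
have fXZ : f X - f X ^+ N.+2 = q%:R * f Z.
  by rewrite -rmorphXn -rmorphB XZ rmorphM rmorph_nat.
(* Multiplying f X = X^(i+1) + q W1 by f X = X V2 + d' W2 puts (f X)^2 in (X, d), hence also (f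
   X)^(N+2). The remainder f X - (f X)^(N+2) = q f Z equals q Z V' + d W', and q Z = X - X^(N+2) is
   a multiple of X. *)
exists ((X ^+ i * f X + q%:R * W1 * V2) * f X ^+ N + (1 - X ^+ N.+1) * V').
exists (W1 * W2 * f X ^+ N + W'); split.
- by do ![apply: closedD | apply: SM | apply: closedX | apply: closedN
         | apply: closed_nat | apply: Sf | done].
- by do ![apply: closedD | apply: SM | apply: closedX | apply: closedN
         | apply: closed_nat | apply: Sf | done].
have sq : f X * f X = X * (X ^+ i * f X + q%:R * W1 * V2) + d%:R * (W1 * W2).
  by rewrite {1}x1' x2 dE natrM; ring.
transitivity (f X * f X * f X ^+ N + q%:R * f Z).
  by rewrite -fXZ !exprS; ring.
rewrite sq fZ; transitivity ((X * (X ^+ i * f X + q%:R * W1 * V2) + d%:R * (W1 * W2)) * f X ^+ N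
    + (q%:R * Z) * V' + d%:R * W').
  by rewrite dE natrM; ring.
by rewrite -XZ !exprS; ring.
Qed.

End SubringCongruence.

(** * Fourier transform on a finite field and units of absolute value 1 *)

Section Fourier.
Variables (K : finFieldType) (F : numFieldType) (e : K -> F).
Hypothesis e0 : e 0 = 1.
Hypothesis eD : forall i j, e (i + j) = e i * e j.
Hypothesis e_inj : forall i, e i = 1 -> i = 0.

Definition hat (f : K -> F) (k : K) : F := \sum_i f i * e (k * i).

Lemma hat0 f : hat f 0 = \sum_i f i.
Proof. by apply: eq_bigr => i _; rewrite mul0r e0 mulr1. Qed.

Lemma sum_char i : \sum_k e (k * i) = if i == 0 then #|K|%:R else 0.
Proof.
case: eqVneq => [->|i0].
  by under eq_bigr do rewrite mulr0 e0; rewrite sumr_const.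
have: (1 - e i) * \sum_k e (k * i) = 0.
  rewrite mulrBl mul1r mulr_sumr [X in X - _](reindex_inj (addIr 1)) /=.
  by apply/eqP; rewrite subr_eq0; apply/eqP/eq_bigr => k _; rewrite mulrDl mul1r addrC eD.
move/eqP; rewrite mulf_eq0 subr_eq0 => /orP[/eqP/esym/e_inj ie|/eqP //].
by rewrite ie eqxx in i0.
Qed.

Lemma parseval f : \sum_k hat f k * hat f (- k) = #|K|%:R * \sum_i f i ^+ 2.
Proof.
transitivity (\sum_i \sum_j f i * f j * \sum_k e (k * (i - j))).
  transitivity (\sum_k \sum_i \sum_j f i * f j * e (k * (i - j))).
    apply: eq_bigr => k _; rewrite mulr_suml; apply: eq_bigr => i _.
    rewrite mulr_sumr; apply: eq_bigr => j _.
    by rewrite mulrBr eD mulNr; ring.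
  rewrite exchange_big; apply: eq_bigr => i _; rewrite exchange_big.
  by apply: eq_bigr => j _; rewrite mulr_sumr.
rewrite mulr_sumr; apply: eq_bigr => i _; rewrite (bigD1 i) //= [X in _ + X]big1 ?addr0 => [|j ji].
  by rewrite sum_char subrr eqxx mulrC expr2.
by rewrite sum_char subr_eq0 eq_sym (negPf ji) mulr0.
Qed.

(** In the inversion formula only frequency 0 survives, so [f] is constant. This will compare the
    indicators of mu A and A + g. *)
Lemma fourier_inversion_const f : (forall k, k != 0 -> hat f k = 0) ->
  forall j, #|K|%:R * f j = \sum_i f i.
Proof.
move=> Hf j; transitivity (\sum_k hat f k * e (- (k * j))).
  transitivity (\sum_i f i * \sum_k e (k * (i - j))).
    rewrite (bigD1 j) //= [X in _ + X]big1 ?addr0 => [|i ij].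
      by rewrite sum_char subrr eqxx mulrC.
    by rewrite sum_char subr_eq0 (negPf ij) mulr0.
  transitivity (\sum_i \sum_k f i * e (k * (i - j))).
    by apply: eq_bigr => i _; rewrite mulr_sumr.
  rewrite exchange_big; apply: eq_bigr => k _; rewrite mulr_suml.
  by apply: eq_bigr => i _; rewrite mulrBr eD mulrA.
rewrite (bigD1 0) //= big1 => [|k k0]; last by rewrite Hf // mul0r.
by rewrite hat0 mul0r oppr0 e0 mulr1 addr0.
Qed.

Lemma hat_shift (f : K -> F) (c : F) k : k != 0 -> hat (fun i => f i - c) k = hat f k.
Proof.
move=> k0; rewrite /hat; under eq_bigr do rewrite mulrBl.
rewrite sumrB -mulr_sumr; under [X in _ * X]eq_bigr do rewrite mulrC.
by rewrite sum_char (negPf k0) mulr0 subr0.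
Qed.

Lemma hat_indicator (A : {set K}) k : hat (fun i => (i \in A)%:R) k = \sum_(i in A) e (k * i).
Proof.
rewrite /hat [RHS]big_mkcond; apply: eq_bigr => i _.
by case: (i \in A); rewrite ?mul1r ?mul0r.
Qed.

Lemma hat_translate (A : {set K}) g k :
  hat (fun i => (i \in [set a + g | a in A])%:R) k = e (k * g) * hat (fun i => (i \in A)%:R) k.
Proof.
rewrite !hat_indicator big_imset /= => [|x y _ _]; last exact: addIr.
by rewrite mulr_sumr; apply: eq_bigr => i _; rewrite mulrDr eD mulrC.
Qed.

Lemma hat_dilate (A : {set K}) g k : g != 0 ->
  hat (fun i => (i \in [set g * a | a in A])%:R) k = hat (fun i => (i \in A)%:R) (g * k).
Proof.
move=> g0; rewrite !hat_indicator big_imset /= => [|x y _ _]; last exact: mulfI.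
by apply: eq_bigr => i _; rewrite mulrA [k * g]mulrC.
Qed.

(* Kronecker's theorem for Z[zeta_p].  The coefficients of a unit are only
   determined up to an additive constant; choosing them with sum +1 or -1 makes
   all the values of the transform have absolute value 1, so that by Parseval
   the squares of the coefficients sum to 1. *)
Lemma trivial_unit (f : K -> int) : prime #|K| ->
  (forall k, k != 0 -> hat (fun i => (f i)%:~R) k * hat (fun i => (f i)%:~R) (- k) = 1) ->
  exists (d : bool) (g : K), forall k, k != 0 ->
    hat (fun i => (f i)%:~R) k = (-1) ^+ d * e (k * g).
Proof.
set q := #|K| => q_pr Hf.
(* Parseval: frequency 0 contributes the squared coefficient sum, and each of the q - 1 others
   contributes 1. *)
have par (h : K -> int) :
    (forall k, k != 0 -> hat (fun i => (h i)%:~R) k * hat (fun i => (h i)%:~R) (- k) = 1) ->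
    (\sum_i h i) ^+ 2 + q%:Z - 1 = q%:Z * \sum_i h i ^+ 2.
  move=> Hh; apply: (@mulrIz F 1); first exact: oner_neq0.
  have hsq : (\sum_i h i ^+ 2)%:~R = \sum_i (h i)%:~R ^+ 2 :> F.
    by rewrite rmorph_sum; apply: eq_bigr => i _; rewrite rmorphXn.
  rewrite expr2 !(intrB, intrD, intrM) hsq rmorph_sum /= -parseval [RHS](bigD1 0) //= oppr0 hat0.
  rewrite [X in _ = _ + X](eq_bigr (fun _ => 1)); last exact: Hh.
  rewrite sumr_const cardC1 -/q -[in LHS](prednK (prime_gt0 q_pr)).
  by rewrite -[q.-1.+1]addn1 PoszD rmorphD /=; ring.
(* Reduced modulo the prime q, the identity reads s^2 = 1, so s is 1 or -1 modulo q; c is the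
   quotient that remains. *)
have := par f Hf; set s := \sum_i f i => Ps.
have : (q%:Z %| (s - 1) * (s + 1))%Z.
  apply/dvdzP; exists ((\sum_i f i ^+ 2) - 1).
  by transitivity (s ^+ 2 + q%:Z - 1 - q%:Z); [ring | rewrite Ps; ring].
rewrite dvdzE abszM Euclid_dvdM // => qs.
have [d [c sE]] : exists (d : bool) (c : int), s = (-1) ^+ d + c * q%:Z.
  case/orP: qs => qs.
    exists false; have /dvdzP[c sc] : (q%:Z %| s - 1)%Z by rewrite dvdzE.
    by exists c; rewrite -sc expr0; ring.
  exists true; have /dvdzP[c sc] : (q%:Z %| s + 1)%Z by rewrite dvdzE.
  by exists c; rewrite -sc expr1; ring.
pose h i := f i - c.
have hatE k : k != 0 -> hat (fun i => (h i)%:~R) k = hat (fun i => (f i)%:~R) k.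
  move=> k0; rewrite -[RHS](hat_shift _ c%:~R k0).
  by apply: eq_bigr => i _; rewrite /h intrB.
have sh : \sum_i h i = (-1) ^+ d.
  by rewrite sumrB sumr_const -/s sE -[c *+ _]mulr_natr natz addrK.
have h2 : \sum_i h i ^+ 2 = 1.
  have Hh : forall k, k != 0 -> hat (fun i => (h i)%:~R) k * hat (fun i => (h i)%:~R) (- k) = 1.
    by move=> k k0; rewrite !hatE ?oppr_eq0 // Hf.
  have := par h Hh; rewrite sh sqrr_sign [1 + _]addrC addrK => /esym/eqP.
  rewrite -[X in _ == X]mulr1 (inj_eq (mulfI _)) => [/eqP //|].
  by rewrite eqz_nat -lt0n prime_gt0.
have [g hg] : exists g, h g != 0.
  apply/existsP; rewrite -negb_forall; apply/negP => /forallP H0.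
  by move: h2; rewrite big1 // => i _; rewrite (eqP (H0 i)) expr0n.
(* A second nonzero integer coefficient would bring the sum of squares to at least 2. *)
have h0 i : i != g -> h i = 0.
  move=> ig; move: h2; rewrite (bigD1 g) //= (bigD1 i) //=.
  set r := \sum_(_ | _) _; have: 0 <= r by apply: sumr_ge0 => j _; apply: sqr_ge0.
  have := exprn_even_gt0 (h g) (isT : ~~ odd 2); rewrite hg => hg2.
  have := exprn_even_gt0 (h i) (isT : ~~ odd 2); case: eqP => //= _ hi2.
  move: (h i ^+ 2) (h g ^+ 2) hg2 hi2 => x y; lia.
have hgE : h g = (-1) ^+ d by rewrite -sh (bigD1 g) //= big1 ?addr0.
exists d, g => k k0; rewrite -hatE // /hat (bigD1 g) //= big1 => [|i /h0->].
  by rewrite hgE addr0 rmorph_sign.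
by rewrite mul0r.
Qed.

End Fourier.

(** * The ring Z[zeta] and the action of Frobenius *)

Section IntegerSpan.
Variables (K : finFieldType) (F : numFieldType) (e : K -> F).
Hypothesis e0 : e 0 = 1.
Hypothesis eD : forall i j, e (i + j) = e i * e j.

(** For [K] = F_p and [e] nontrivial this is Z[zeta]. Coefficients are indexed by all of [K], which
    makes multiplication a convolution at the price of uniqueness. *)
Definition zspan (z : F) := exists f : K -> int, z = hat e (fun i => (f i)%:~R) 1.

Lemma zspan_char i : zspan (e i).
Proof.
exists (fun j => (j == i)%:Z); rewrite /hat (bigD1 i) //= big1 => [|j /negPf->].
  by rewrite eqxx !mul1r addr0.
by rewrite mul0r.
Qed.

Lemma zspan1 : zspan 1. Proof. by rewrite -e0; apply: zspan_char. Qed.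

Lemma zspanB x y : zspan x -> zspan y -> zspan (x - y).
Proof.
move=> [f ->] [g ->]; exists (fun i => f i - g i); rewrite -sumrB.
by apply: eq_bigr => i _; rewrite intrB mulrBl.
Qed.

Lemma zspanM x y : zspan x -> zspan y -> zspan (x * y).
Proof.
move=> [f ->] [g ->]; exists (fun l => \sum_i f i * g (l - i)).
transitivity (\sum_i \sum_l (f i * g (l - i))%:~R * e (1 * l)).
  rewrite /hat mulr_suml; apply: eq_bigr => i _.
  rewrite mulr_sumr (reindex_inj (addIr (- i))) /=; apply: eq_bigr => l _.
  have ->: e (1 * l) = e (l - i) * e i by rewrite mul1r -eD subrK.
  by rewrite intrM !mul1r; ring.
rewrite exchange_big; apply: eq_bigr => l _.
by rewrite rmorph_sum mulr_suml.
Qed.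

Notation zint := (closed_int zspan1 zspanB).

Lemma zspan_hat (f : K -> int) k : zspan (hat e (fun i => (f i)%:~R) k).
Proof.
apply: (closed_sum zspan1 zspanB) => i _; apply: zspanM; last exact: zspan_char.
exact: zint.
Qed.

(** Modulo q, the q-th power is additive, fixes integer coefficients by Fermat and sends e(i) to e(q
    i); iterate j times. *)
Lemma hat_frobenius q j (f : K -> int) k : prime q ->
  eqmodS zspan q (hat e (fun i => (f i)%:~R) k ^+ (q ^ j))
    (hat e (fun i => (f i)%:~R) (k * q%:R ^+ j)).
Proof.
move=> q_pr; elim: j => [|j IH].
  by rewrite expn0 !expr1 mulr1; apply: (eqmodS_refl zspan1 zspanB).
set g := fun i => (f i)%:~R in IH *.
have eX i n : e i ^+ n = e (i * n%:R).
  by elim: n => [|n IHn]; rewrite ?mulr0 ?e0 // exprS IHn -eD -natr1 mulrDr mulr1 addrC.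
apply: (eqmodS_trans zspan1 zspanB (y := hat e g (k * q%:R ^+ j) ^+ q)).
  rewrite expnSr exprM; apply: (eqmodS_exp zspan1 zspanB zspanM) => //.
    by apply: (closedX zspan1 zspanM); apply: zspan_hat.
  exact: zspan_hat.
apply: (eqmodS_trans zspan1 zspanB); first apply: (eqmodS_exp_sum zspan1 zspanB zspanM) => //.
  by move=> i; apply: zspanM; [apply: zint | apply: zspan_char].
apply: (eqmodS_sum zspan1 zspanB) => i; rewrite exprMn eX.
have ->: k * q%:R ^+ j * i * q%:R = k * q%:R ^+ j.+1 * i by rewrite exprS; ring.
apply: (eqmodS_mulr zspanM); first exact: zspan_char.
exact: (eqmodS_fermat zspan1 zspanB).
Qed.

(** Since q is nonzero in [K], some power of Frobenius is the identity modulo q, which is the form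
    in which unramifiedness enters; and [f] agrees modulo q with the q^j-th power because mu =
    q^j. *)
Lemma galois_in_ideal (f : {rmorphism F -> F}) (mu : K) (d : nat) :
  (forall i, f (e i) = e (mu * i)) -> (0 < d)%N ->
  (forall q, prime q -> (q %| d)%N ->
     q%:R != 0 :> K /\ exists j, mu = q%:R ^+ j) ->
  forall X, zspan X ->
  exists V W, [/\ zspan V, zspan W & f X = X * V + d%:R * W].
Proof.
move=> fe d_gt0 Hd.
have f_hat (g : K -> int) : f (hat e (fun i => (g i)%:~R) 1) = hat e (fun i => (g i)%:~R) mu.
  by rewrite rmorph_sum; apply: eq_bigr => i _; rewrite rmorphM rmorph_int fe mul1r.
apply: (rmorph_in_ideal zspan1 zspanB zspanM) => //.
  by move=> x [g ->]; rewrite f_hat; apply: zspan_hat.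
move=> q q_pr /(Hd q q_pr)[q0 [j muE]]; split.
  have K1 := finNzRing_gt1 K.
  have qK : q%:R ^+ #|K|.-1 = 1 :> K.
    apply: (mulfI q0); rewrite -exprS mulr1 prednK ?expf_card //.
    exact: ltnW.
  have qK2 : (1 < q ^ #|K|.-1)%N.
    by rewrite -{1}(expn0 q) ltn_exp2l ?prime_gt1 // -ltnS prednK // ltnW.
  (* The exponent is q^(#|K| - 1), as q^(#|K| - 1) = 1 in [K]; it is at least 2, as the form n + 2
     demands. *)
  exists (q ^ #|K|.-1).-2 => X [g ->]; apply: (eqmodS_sym zspan1 zspanB).
  have ->: (q ^ #|K|.-1).-2.+2 = (q ^ #|K|.-1)%N by lia.
  by have := hat_frobenius #|K|.-1 g 1 q_pr; rewrite qK mulr1.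
move=> X [g ->]; exists (q ^ j).-1; rewrite prednK ?expn_gt0 ?prime_gt0 // f_hat.
apply: (eqmodS_sym zspan1 zspanB).
by have := hat_frobenius j g 1 q_pr; rewrite mul1r -muE.
Qed.

End IntegerSpan.

(** * Quadratic residues modulo an odd prime *)

Section Residues.
Variables (p : nat).
Hypothesis p_pr : prime p.
Hypothesis two_neq0 : 2 != 0 :> 'F_p.
Notation R := (QR p).

Lemma QR_neq0 x : x \in R -> x != 0.
Proof. by rewrite inE => /andP[]. Qed.

Lemma QR1 : 1 \in R.
Proof. by rewrite inE oner_neq0; apply/existsP; exists 1; rewrite expr1n. Qed.

Lemma QR_sqr x : x != 0 -> x ^+ 2 \in R.
Proof. by move=> x0; rewrite inE sqrf_eq0 x0; apply/existsP; exists x. Qed.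

Lemma QRM x y : x \in R -> (x * y \in R) = (y \in R).
Proof.
rewrite inE => /andP[x0 /existsP[u /eqP ux]].
have u0 : u != 0 by apply: contraNneq x0 => u0; rewrite -ux u0 expr0n.
rewrite !inE mulf_eq0 negb_or x0 /=; congr (_ && _); apply/existsP/existsP => -[w /eqP wE].
  by exists (w / u); rewrite exprMn exprVn wE ux mulrC mulKf.
by exists (u * w); rewrite exprMn wE ux.
Qed.

(** Squaring maps the nonzero elements onto [R] with fibres {u, -u} of size 2. *)
Lemma card_QR : (#|R| * 2 = p.-1)%N.
Proof.
rewrite -[in RHS](card_Fp p_pr) -(cardC1 (0 : 'F_p)) -[in RHS]sum1_card.
rewrite (partition_big (fun y => y ^+ 2) (mem R)) => [|y]; last first.
  by move=> y0; apply: QR_sqr.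
rewrite -sum_nat_const; apply: eq_bigr => x; rewrite inE => /andP[x0 /existsP[u /eqP ux]].
have u0 : u != 0 by apply: contraNneq x0 => u0; rewrite -ux u0 expr0n.
rewrite sum1_card; transitivity #|[set u; - u]|.
  rewrite cards2 -addr_eq0 -mulr2n -mulr_natr mulf_eq0 negb_or u0 /=.
  by rewrite two_neq0.
apply: eq_card => y; rewrite !inE [in RHS]unfold_in !inE -ux eqf_sqr.
have [->|_] := eqVneq y u; first by rewrite u0.
by have [->|_] := eqVneq y (- u); rewrite ?oppr_eq0 ?u0 ?andbF.
Qed.

Lemma nonresidue_exists : exists2 nu : 'F_p, nu != 0 & nu \notin R.
Proof.
have lt : (#|R| < #|[set~ 0%R : 'F_p]|)%N.
  rewrite cardsC1 card_Fp // -card_QR -{1}[#|R|]muln1 ltn_pmul2l //.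
  by apply/card_gt0P; exists 1; apply: QR1.
have : ~~ ([set~ 0] \subset R) by apply: contraL lt => /subset_leq_card; rewrite leqNgt.
by case/subsetPn => nu; rewrite !inE => nu0 nuR; exists nu; rewrite ?inE.
Qed.

Lemma QR_dilate r : r \in R -> [set r * x | x in R] = R.
Proof.
move=> rR; apply/eqP; rewrite eqEcard card_imset ?leqnn ?andbT; last exact/mulfI/QR_neq0.
by apply/subsetP => _ /imsetP[x xR ->]; rewrite QRM.
Qed.

(** One inclusion is multiplicativity; equality follows because residues and nonresidues are equally
    many. *)
Lemma nonresidue_dilate nu : nu != 0 -> nu \notin R ->
  [set nu * x | x in R] = [set x | (x != 0) && (x \notin R)].
Proof.
move=> nu0 nuR; apply/eqP; rewrite eqEcard card_imset; last exact: mulfI.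
apply/andP; split.
  apply/subsetP => _ /imsetP[x xR ->]; rewrite inE mulf_neq0 ?(QR_neq0 xR) //.
  by rewrite mulrC QRM.
have := cardsD1 0 [set: 'F_p]; have := cardsID R ([set: 'F_p] :\ 0).
have ->: ([set: 'F_p] :\ 0) :&: R = R.
  by apply/setIidPr/subsetP => x /QR_neq0; rewrite !inE => ->.
have ->: ([set: 'F_p] :\ 0) :\: R = [set x | (x != 0) && (x \notin R)].
  by apply/setP => x; rewrite !inE andbC andbT.
rewrite cardsT card_Fp ?inE // => h1 /= h2; have := card_QR; rewrite [in RHS]h2 -h1.
by rewrite add1n /= muln2 -addnn => /addnI ->.
Qed.

Lemma sum_residues (V : nmodType) (G : 'F_p -> V) nu : nu != 0 -> nu \notin R ->
  \sum_(x | x != 0) G x = \sum_(x in R) G x + \sum_(x in R) G (nu * x).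
Proof.
move=> nu0 nuR; rewrite (bigID (mem R)) /=; congr (_ + _).
  by apply: eq_bigl => x; rewrite andb_idl // => /QR_neq0.
rewrite -(big_imset G (h := fun x => nu * x)) => [|x y _ _]; last exact: mulfI.
by rewrite nonresidue_dilate //; apply: eq_bigl => x; rewrite [RHS]inE.
Qed.

End Residues.

(** * Character sums of a set with A - A = R, and its multipliers *)

Section DifferenceSet.
Variables (p : nat) (A : {set 'F_p}).
Hypothesis p_pr : prime p.
Notation R := (QR p).
Hypothesis diffA : diff_exact A R.

Lemma diff_representation1 :
  exists u : 'F_p * 'F_p, [/\ [set u in setX A A | u.1 - u.2 == 1] = [set u],
    u.1 \in A, u.2 \in A & u.1 = u.2 + 1].
Proof.
have /eqP/cards1P[u uE] := diffA.1 _ (QR1 p).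
have := set11 u; rewrite -uE !inE => /andP[/andP[u1 u2] /eqP u12].
by exists u; split=> //; rewrite addrC -u12 subrK.
Qed.

(** Swapping the pair that represents 1 exhibits -1 as a difference of distinct elements. *)
Lemma diff_neg1_QR : -1 \in R.
Proof.
have [u [_ u1 u2 u12]] := diff_representation1.
have -> : -1 = u.2 - u.1 by rewrite u12 opprD addrA subrr add0r.
by apply: diffA.2 => //; rewrite u12 -subr_eq0 opprD addrA subrr add0r oppr_eq0 oner_neq0.
Qed.

(** If 2 = 0, the swapped pair is a second representation of 1. *)
Lemma diff_two_neq0 : 2 != 0 :> 'F_p.
Proof.
have [u [uE u1 u2 u12]] := diff_representation1.
apply/negP => two0; have: (u.2, u.1) \in [set u].
  by rewrite -uE !inE /= u1 u2 u12 opprD addrA subrr add0r eq_sym -addr_eq0.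
rewrite inE => /eqP uu; have /eqP := u12; rewrite -{2}uu /=.
by rewrite -subr_eq0 opprD addrA subrr add0r oppr_eq0 oner_eq0.
Qed.

Let two_neq0 := diff_two_neq0.

Variable e : 'F_p -> algC.
Hypothesis e0 : e 0 = 1.
Hypothesis eD : forall i j, e (i + j) = e i * e j.
Hypothesis e_inj : forall i, e i = 1 -> i = 0.
Hypothesis e_Aint : forall i, e i \in Aint.
Hypothesis e_aut : forall k, k != 0 ->
  exists f : {rmorphism algC -> algC}, forall i, f (e i) = e (k * i).

Notation indic B := (fun i => ((i \in B)%:Z)%:~R).
Notation al := (hat e (indic A)).
Notation eta := (hat e (indic R)).

Lemma sum_indic (B : {set 'F_p}) : \sum_i ((i \in B)%:Z)%:~R = #|B|%:R :> algC.
Proof.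
rewrite -sum1_card natr_sum [RHS]big_mkcond; apply: eq_bigr => i _.
by case: (i \in B).
Qed.

(** Group the pairs by their difference: 0 occurs #|A| times, each residue once, nothing else
    occurs. *)
Lemma autocorrelation k : al k * al (- k) = #|A|%:R + eta k.
Proof.
have -> : al k * al (- k) = \sum_(u in setX A A) e (k * (u.1 - u.2)).
  transitivity (\sum_(i in A) \sum_(j in A) e (k * (i - j))).
    rewrite !hat_indicator mulr_suml; apply: eq_bigr => i _; rewrite mulr_sumr.
    by apply: eq_bigr => j _; rewrite mulrBr eD mulNr.
  by rewrite pair_big; apply: eq_bigl => u; rewrite inE.
rewrite (partition_big (fun u => u.1 - u.2) predT) //=.
have cnt s : \sum_(u in setX A A | u.1 - u.2 == s) e (k * (u.1 - u.2)) =
    #|[set u in setX A A | u.1 - u.2 == s]|%:R * e (k * s).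
  rewrite mulr_natl -sumr_const; apply: eq_big => [u|u /andP[_ /eqP ->] //].
  by rewrite !inE.
under eq_bigr do rewrite cnt.
rewrite (bigD1 0) //=; congr (_ + _).
  rewrite mulr0 e0 mulr1; congr _%:R.
  rewrite -[RHS](card_imset _ (f := fun x => (x, x))); last by move=> x y [].
  apply: eq_card => -[x y]; rewrite !inE /= subr_eq0; apply/andP/imsetP.
    by move=> [/andP[xA _] /eqP <-]; exists x.
  by move=> [z zA [-> ->]]; rewrite zA.
rewrite /hat [RHS](bigD1 0) //= (_ : (0 \in R) = false) ?mul0r ?add0r; last first.
  by rewrite inE eqxx.
apply: eq_bigr => s s0; congr (_ * _).
have [sR|sR] := boolP (s \in R); first by rewrite diffA.1.
rewrite (_ : [set _ in _ | _] = set0) ?cards0 //.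
apply/setP => u; rewrite !inE; apply/negP => /andP[/andP[u1 u2] /eqP us].
by case/negP: sR; rewrite -us diffA.2 // -subr_eq0 us.
Qed.

Lemma hat_residues_QR r k : r \in R -> eta (r * k) = eta k.
Proof. by move=> rR; rewrite -(hat_dilate e R k (QR_neq0 rR)) QR_dilate. Qed.

Lemma hat_residuesN k : eta (- k) = eta k.
Proof. by rewrite -mulN1r hat_residues_QR // diff_neg1_QR. Qed.

Let n := #|A|.
Let m := (p.-1 %/ 4)%N.

Lemma card_diff : (n * n = n + #|R|)%N.
Proof.
apply/eqP; rewrite -(eqr_nat algC) natrD natrM.
by have := autocorrelation 0; rewrite oppr0 !hat0 // !sum_indic => ->.
Qed.

(** Here n^2 - n = #|R| = (p - 1) / 2 is even, so the division by 4 in [m] is exact. *)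
Lemma diff_card_QR : #|R| = (2 * m)%N.
Proof.
have h := card_QR p_pr two_neq0.
have: ~~ odd #|R|.
  by have := congr1 odd card_diff; rewrite oddM oddD andbb; case: odd; case: odd.
by rewrite -dvdn2 => /dvdnP[k kE]; move: h; rewrite /m kE; lia.
Qed.

Lemma diff_pE : p = (4 * m + 1)%N.
Proof. by have := card_QR p_pr two_neq0; rewrite diff_card_QR; have := prime_gt0 p_pr; lia. Qed.

Lemma diff_m_gt0 : (0 < m)%N.
Proof. by have := prime_gt1 p_pr; rewrite {1}diff_pE; lia. Qed.

Lemma diff_nE : (n * n = n + 2 * m)%N.
Proof. by rewrite card_diff diff_card_QR. Qed.

Section Nonresidue.
Variable nu : 'F_p.
Hypotheses (nu0 : nu != 0) (nuR : nu \notin R).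

Lemma gauss_period_sum : eta 1 + eta nu = -1.
Proof.
have := sum_char e0 eD e_inj 1; rewrite (negPf (oner_neq0 _)) (bigD1 0) //= mul0r e0.
rewrite (sum_residues p_pr two_neq0 _ nu0 nuR) => /eqP; rewrite addrC addr_eq0 => /eqP <-.
rewrite !hat_indicator; congr (_ + _); apply: eq_bigr => x _; first by rewrite mulrC.
by rewrite mulr1.
Qed.

(** Parseval for the indicator of [R], whose transform takes the values [eta 1] and [eta nu] #|R|
    times each: dividing by #|R| leaves p - #|R| = 2m + 1. No Gauss sum has to be evaluated. *)
Lemma gauss_period_sum_sqr : eta 1 ^+ 2 + eta nu ^+ 2 = (2 * m + 1)%:R.
Proof.
have := parseval e0 eD e_inj (indic R).
have -> : \sum_i ((i \in R)%:Z)%:~R ^+ 2 = #|R|%:R :> algC.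
  by rewrite -sum_indic; apply: eq_bigr => i _; case: (i \in R); rewrite ?expr1n ?expr0n.
under eq_bigr do rewrite hat_residuesN -expr2.
rewrite card_Fp // (bigD1 0) //= hat0 // sum_indic (sum_residues p_pr two_neq0 _ nu0 nuR).
rewrite (eq_bigr (fun _ => eta 1 ^+ 2)) => [|x xR]; last first.
  by rewrite -[x]mulr1 hat_residues_QR.
rewrite [X in _ + (_ + X)](eq_bigr (fun _ => eta nu ^+ 2)) => [|x xR]; last first.
  by rewrite mulrC hat_residues_QR.
rewrite !sumr_const -mulrnDl => H; rewrite -[X in _ + X = _]mulr_natr in H.
have R0 : #|R|%:R != 0 :> algC.
  by rewrite pnatr_eq0 diff_card_QR; have := diff_m_gt0; lia.
apply: (mulIf R0); apply: (addrI (#|R|%:R ^+ 2)); rewrite H.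
rewrite {1}diff_pE diff_card_QR !(natrD, natrM); ring.
Qed.

(** This is alpha alpha' = m. The two period identities give eta(1) eta(nu) = -m, and n^2 - n = 2m
    does the rest. *)
Lemma norm_period : (n%:R + eta 1) * (n%:R + eta nu) = m%:R.
Proof.
have s1 := gauss_period_sum; have s2 := gauss_period_sum_sqr.
have nE : n%:R * n%:R = n%:R + 2 * m%:R :> algC by rewrite -!(natrM, natrD) diff_nE.
have e2 : eta nu = -1 - eta 1 by rewrite -s1 addrAC subrr add0r.
have H : 2 * (eta 1 * eta nu) = - (2 * m%:R).
  transitivity ((eta 1 + eta nu) ^+ 2 - (eta 1 ^+ 2 + eta nu ^+ 2)); first by ring.
  by rewrite s1 s2 natrD natrM; ring.
have two0 : 2 != 0 :> algC by rewrite pnatr_eq0.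
apply: (mulfI two0).
transitivity (2 * (n%:R * n%:R) + 2 * n%:R * (eta 1 + eta nu) + 2 * (eta 1 * eta nu)).
  by ring.
by rewrite s1 H nE; ring.
Qed.

End Nonresidue.

Variable mu : 'F_p.
Hypothesis mu0 : mu != 0.
Hypothesis mu_powers : forall q, prime q -> (q %| m)%N -> exists j, mu = q%:R ^+ j.
(** For m = 1, that is p = 5, no prime divides m and [mu_powers] gives no information about mu. *)
Hypothesis mu_trivial : m = 1%N -> mu = 1.

(** Each value is one of two factors with product m <> 0; this permits cancelling a(k) a(-k). *)
Lemma character_sum_norm_neq0 k : k != 0 -> n%:R + eta k != 0.
Proof.
have m0 : m%:R != 0 :> algC by rewrite pnatr_eq0 -lt0n diff_m_gt0.
have [nu nu0 nuR] := nonresidue_exists p_pr two_neq0.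
have := norm_period nu0 nuR; move=> E k0; rewrite -E mulf_eq0 negb_or in m0.
case/andP: m0 => n1 n2.
have [kR|kR] := boolP (k \in R); first by rewrite -[k]mulr1 hat_residues_QR.
have : k \in [set nu * x | x in R] by rewrite nonresidue_dilate // inE k0.
by case/imsetP => x xR ->; rewrite mulrC hat_residues_QR.
Qed.

Lemma character_sum_dilate : exists g : 'F_p -> int,
  forall k, k != 0 -> al (mu * k) = al k * hat e (fun i => (g i)%:~R) k.
Proof.
have f_hat (f : {rmorphism algC -> algC}) k (g : 'F_p -> int) j :
    (forall i, f (e i) = e (k * i)) ->
    f (hat e (fun i => (g i)%:~R) j) = hat e (fun i => (g i)%:~R) (k * j).
  move=> fe; rewrite rmorph_sum; apply: eq_bigr => i _.
  by rewrite rmorphM rmorph_int fe mulrA.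
have [f fe] := e_aut mu0.
have [|V [W [zV zW E]]] := galois_in_ideal e0 eD fe diff_m_gt0 _
  (zspan_hat e0 eD (fun i => (i \in A)%:Z) 1).
  move=> q q_pr qm; split; last exact: mu_powers.
  rewrite -(dvdn_pcharf (pchar_Fp p_pr)) gtnNdvd ?prime_gt0 //.
  by rewrite diff_pE; have := dvdn_leq diff_m_gt0 qm; lia.
have [nu nu0 nuR] := nonresidue_exists p_pr two_neq0.
(* From f(a(1)) = a(1) V + m W and m = a(1) a(-1) alpha', the quotient a(mu) / a(1) is read off. *)
have zU : zspan e (V + al (-1) * (n%:R + eta nu) * W).
  apply: (closedD (zspan1 e0) (zspanB (e := e))) => //; do ![apply: zspanM => //].
    exact: zspan_hat.
  apply: (closedD (zspan1 e0) (zspanB (e := e))); last exact: zspan_hat.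
  exact: (closed_nat (zspan1 e0) (zspanB (e := e))).
(* The automorphism zeta -> zeta^k carries the identity at frequency 1 to frequency k, with the same
   coefficients [g]. *)
have [g gE] := zU; exists g => k k0; have [h he] := e_aut k0.
have E1 : al mu = al 1 * hat e (fun i => (g i)%:~R) 1.
  rewrite -gE -[in LHS](mulr1 mu) -(f_hat _ _ (fun i => (i \in A)%:Z) _ fe) E.
  rewrite -(norm_period nu0 nuR) -autocorrelation; ring.
have := congr1 h E1; rewrite rmorphM !(f_hat _ _ _ _ he) mulr1 => <-.
by rewrite [mu * k]mulrC.
Qed.

(** For a nonresidue mu, v(1) = alpha' / alpha and v(mu) = alpha / alpha' would both be algebraic
    integers; their sum is 6 + 1/m, which forces m = 1 and mu = 1. *)
Lemma multiplier_is_QR : mu \in R.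
Proof.
apply/negPn/negP => muR; have [g gE] := character_sum_dilate.
pose v k := hat e (fun i => (g i)%:~R) k * hat e (fun i => (g i)%:~R) (- k).
have vE k : k != 0 -> n%:R + eta (mu * k) = (n%:R + eta k) * v k.
  move=> k0; rewrite -!autocorrelation -mulrN !gE ?oppr_eq0 // /v; ring.
have v_Aint k : v k \in Aint.
  by apply: rpredM; apply: rpred_sum => i _; apply: rpredM => //; apply: rpred_int.
have := vE 1 (oner_neq0 _); have := vE mu mu0; rewrite mulr1 => v2 v1.
have eta_mu2 : eta (mu * mu) = eta 1.
  by rewrite -[mu * mu]mulr1 hat_residues_QR // -expr2 QR_sqr.
rewrite eta_mu2 in v2.
(* With a + b = 2n - 1 and a b = m: a^2 + b^2 = (2n - 1)^2 - 2m = 6m + 1, using n^2 - n = 2m. *)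
have sE : m%:R * (v 1 + v mu - 6) = 1.
  have s1 := gauss_period_sum mu0 muR; have nrm := norm_period mu0 muR.
  have nE : n%:R * n%:R = n%:R + 2 * m%:R :> algC by rewrite -!(natrM, natrD) diff_nE.
  set a := n%:R + eta 1 in v1 v2 nrm *; set b := n%:R + eta mu in v1 v2 nrm *.
  transitivity (b * (a * v 1) + a * (b * v mu) - 6 * m%:R); first by rewrite -nrm; ring.
  rewrite -v1 -v2; transitivity ((a + b) ^+ 2 - 8 * m%:R : algC); first by rewrite -nrm; ring.
  have -> : a + b = 2 * n%:R - 1.
    by rewrite /a /b addrACA s1; ring.
  transitivity (4 * (n%:R * n%:R) - 4 * n%:R + 1 - 8 * m%:R : algC); first by ring.
  by rewrite nE; ring.
have m0 : m%:R != 0 :> algC by rewrite pnatr_eq0 -lt0n diff_m_gt0.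
have : v 1 + v mu - 6 \in Num.int.
  apply: Cint_rat_Aint; last by rewrite rpredB ?rpredD ?rpred_nat.
  by rewrite -(mulKf m0 (_ - _)) sE mulr1 rpredV rpred_nat.
case/intrP => z zE; move: sE; rewrite zE => /eqP.
rewrite -[m%:R]/((m%:Z)%:~R) -intrM -[1]/(1%:~R) eqr_int => /eqP mz.
have m1 : m = 1%N.
  by have /eqP := congr1 absz mz; rewrite abszM muln_eq1 => /andP[/eqP].
by move: muR; rewrite (mu_trivial m1) QR1.
Qed.

Lemma multiplier_of_powers : is_multiplier A mu.
Proof.
have [g gE] := character_sum_dilate.
(* As mu is a residue, a(k) a(-k) does not change under k -> mu k, so the quotient satisfies u(k)
   u(-k) = 1. *)
have [d [g0 g0E]] : exists (d : bool) (g0 : 'F_p), forall k, k != 0 ->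
    hat e (fun i => (g i)%:~R) k = (-1) ^+ d * e (k * g0).
  apply: trivial_unit => //; first by rewrite card_Fp.
  move=> k k0; have := autocorrelation (mu * k).
  rewrite hat_residues_QR ?multiplier_is_QR // -autocorrelation -mulrN !gE ?oppr_eq0 //.
  move=> E; apply: (mulfI (character_sum_norm_neq0 k0)).
  rewrite mulr1 -autocorrelation -[RHS]E; ring.
(* The transform of [F] vanishes off 0, so [F] is constant with p F = n - (-1)^d n. *)
pose F i : algC := (i \in [set mu * a | a in A])%:R - (-1) ^+ d * (i \in [set a + g0 | a in A])%:R.
have hatF k : k != 0 -> hat e F k = 0.
  move=> k0; transitivity (hat e (fun i => (i \in [set mu * a | a in A])%:R) k
     - (-1) ^+ d * hat e (fun i => (i \in [set a + g0 | a in A])%:R) k).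
    by rewrite mulr_sumr -sumrB; apply: eq_bigr => i _; rewrite /F; ring.
  rewrite hat_dilate // hat_translate // mulrA -g0E // -[X in X - _]/(al (mu * k)) gE // mulrC.
  exact: subrr.
have sF : \sum_i F i = n%:R - (-1) ^+ d * n%:R.
  rewrite sumrB -mulr_sumr; congr (_ - _ * _).
    by rewrite sum_indic card_imset //; apply: mulfI.
  by rewrite sum_indic card_imset //; apply: addIr.
have p0 : p%:R != 0 :> algC by rewrite pnatr_eq0 -lt0n prime_gt0.
have FE := fourier_inversion_const e0 eD e_inj hatF; rewrite card_Fp // sF in FE.
split=> //; exists g0; case: d @F {hatF sF g0E} FE => F FE.
  (* Sign -1: p F(0) = 2n with F(0) an integer, so p = 4m + 1 divides n, too large for n^2 = n +
     2m. *)
  have /eqP := FE 0; rewrite /F !expr1 !mulN1r !opprK -!natrD -natrM eqr_nat => /eqP.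
  set c := (X in (p * X)%N) => pc; have pdiv : (p %| n)%N.
    have : (p %| 2 * n)%N by rewrite mul2n -addnn -pc dvdn_mulr.
    rewrite Euclid_dvdM // => /orP[p2|//].
    by move: two_neq0; rewrite -(dvdn_pcharf (pchar_Fp p_pr)) p2.
  have n_gt0 : (0 < n)%N.
    by have := diff_nE; have := diff_m_gt0; case: n => //; lia.
  have n_ge : (4 * m + 1 <= n)%N by rewrite -diff_pE dvdn_leq.
  by have := diff_nE; have := diff_m_gt0; move: n_ge; move: (n) (m) => x y; nia.
(* Sign +1: the constant is 0, so the two indicators agree. *)
apply/setP => i; have /eqP := FE i.
rewrite /F expr0 !mul1r subrr mulf_eq0 (negPf p0) /= subr_eq0 eqr_nat.
by case: (i \in _); case: (i \in _).
Qed.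

End DifferenceSet.

(** * A faithful additive character of F_p and its Galois conjugates *)

Lemma additive_character p : prime p ->
  exists e : 'F_p -> algC, [/\ e 0 = 1, forall i j, e (i + j) = e i * e j,
    forall i, e i = 1 -> i = 0, forall i, e i \in Aint &
    forall k, k != 0 -> exists f : {rmorphism algC -> algC}, forall i, f (e i) = e (k * i)].
Proof.
move=> p_pr; have [z z_prim] := C_prim_root_exists (prime_gt0 p_pr).
have modp n : z ^+ (n %% (Zp_trunc (pdiv p)).+2) = z ^+ n.
  by rewrite Fp_cast // prim_expr_mod.
have ltp (i : 'F_p) : (i < p)%N by rewrite -{2}(Fp_cast p_pr) ltn_ord.
exists (fun i => z ^+ i); split=> [|i j|i||k k0].
- by rewrite expr0.
- by rewrite modp exprD.
- move/eqP; rewrite -(prim_order_dvd z_prim) => pi; apply: val_inj => /=.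
  by apply/eqP; rewrite -leqn0 leqNgt; apply/negP => /dvdn_leq/(_ pi); rewrite leqNgt ltp.
- by move=> i; apply: rpredX; apply: Aint_prim_root z_prim.
have [|f fE] := @Qn_aut_exists k p.
  by rewrite coprime_sym prime_coprime // gtnNdvd // lt0n.
by exists f => i; rewrite modp rmorphXn (fE z (prim_expr_order z_prim)) exprM.
Qed.

(** * Multiplicative orders and G_p *)

Lemma Fp_nat_neq0 p q : prime p -> (0 < q < p)%N -> q%:R != 0 :> 'F_p.
Proof. by move=> p_pr /andP[q0 qp]; rewrite -(dvdn_pcharf (pchar_Fp p_pr)) gtnNdvd. Qed.

Lemma Fp_expf_order p (x : 'F_p) : prime p -> x != 0 -> x ^+ p.-1 = 1.
Proof.
move=> p_pr x0; apply: (mulfI x0); rewrite -exprS prednK ?prime_gt0 //.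
by rewrite mulr1 -[X in _ ^+ X](card_Fp p_pr) expf_card.
Qed.

Lemma ordp_primitive p q : prime p -> (0 < q < p)%N ->
  (ordp p q).-primitive_root (q%:R : 'F_p) /\ (ordp p q %| p.-1)%N.
Proof.
move=> p_pr /(Fp_nat_neq0 p_pr) q0.
have p1 : (0 < p.-1)%N by rewrite -ltnS prednK ?prime_gt1 ?prime_gt0.
have [d d_prim d_dvd] := prim_order_exists p1 (Fp_expf_order p_pr q0).
suff -> : ordp p q = d by [].
have d_gt0 := prim_order_gt0 d_prim; have d_le := dvdn_leq p1 d_dvd.
(* The filter keeps exactly the multiples of the true order d; cutting the range just before d shows
   that d comes first. *)
rewrite /ordp (eq_filter (a2 := fun k => (d %| k)%N)) => [|k]; last first.
  rewrite (prim_order_dvd d_prim) -natrX -(inj_eq val_inj) /= val_Fp_nat //.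
  by congr (_ == _); rewrite -(val_Fp_nat p_pr).
have -> : p.-1 = (d.-1 + (p.-1 - d).+1)%N by lia.
rewrite iotaD filter_cat add1n prednK //= dvdnn.
rewrite (eq_in_filter (a2 := pred0)) ?filter_pred0 //= => k.
by rewrite mem_iota => kd; rewrite gtnNdvd; lia.
Qed.

Lemma foldr_gcdn_dvd (s : seq nat) d : d \in s -> (foldr gcdn 0 s %| d)%N.
Proof.
elim: s => //= a s IH; rewrite inE => /orP[/eqP->|/IH]; first exact: dvdn_gcdl.
by apply: dvdn_trans; apply: dvdn_gcdr.
Qed.

Lemma Gp_dvd_ordp p q : prime q -> (q %| p.-1 %/ 4)%N -> (0 < p.-1 %/ 4)%N ->
  (Gp p %| ordp p q)%N.
Proof.
move=> q_pr q_dvd m0; have: q \in primes (p.-1 %/ 4) by rewrite mem_primes q_pr m0.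
rewrite /Gp; case: primes => // a s qs.
by apply: foldr_gcdn_dvd; apply: map_f.
Qed.

(** For m > 1, G_p divides the order of any prime factor of m; for m = 1 the convention G_p = 1
    applies. *)
Lemma Gp_dvd_predp p : prime p -> (0 < p.-1 %/ 4)%N -> (Gp p %| p.-1)%N.
Proof.
move=> p_pr m0; have [m1|m1] := leqP (p.-1 %/ 4) 1.
  have m_eq1 : (p.-1 %/ 4 = 1)%N by lia.
  by rewrite /Gp m_eq1 dvd1n.
have qd := pdiv_dvd (p.-1 %/ 4); have q_pr := pdiv_prime m1.
apply: dvdn_trans (Gp_dvd_ordp q_pr qd m0) _.
apply: (ordp_primitive p_pr _).2; rewrite pdiv_gt0.
by have := dvdn_leq m0 qd; have := prime_gt0 p_pr; lia.
Qed.

(** * The multiplier subgroup and the conclusion *)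

Lemma multiplierP p (A : {set 'F_p}) mu : reflect (is_multiplier A mu) (mu \in mult_set A).
Proof.
rewrite inE; apply: (iffP andP) => -[mu0].
  by move=> /existsP[g /eqP gE]; split=> //; exists g.
by move=> [g gE]; split=> //; apply/existsP; exists g; apply/eqP.
Qed.

Lemma is_multiplierM p (A : {set 'F_p}) x y :
  is_multiplier A x -> is_multiplier A y -> is_multiplier A (x * y).
Proof.
move=> [x0 [g gE]] [y0 [h hE]]; split; first exact: mulf_neq0.
exists (g + x * h).
have -> : [set x * y * a | a in A] = [set x * b | b in [set y * a | a in A]].
  by rewrite -imset_comp; apply: eq_imset => a /=; rewrite mulrA.
rewrite hE -imset_comp.
have -> : [set ((fun b => x * b) \o +%R^~ h) a | a in A] =
    [set b + x * h | b in [set x * a | a in A]].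
  by rewrite -imset_comp; apply: eq_imset => a /=; rewrite mulrDr.
by rewrite gE -imset_comp; apply: eq_imset => a /=; rewrite addrA.
Qed.

Lemma is_multiplier1 p (A : {set 'F_p}) : is_multiplier A 1.
Proof.
split; first exact: oner_neq0.
by exists 0; apply: eq_imset => a; rewrite mul1r addr0.
Qed.

(** The unit group is cyclic of order p - 1, so it has an element [x] of order d; this is a
    multiplier, and Lagrange applies in the group of multipliers. *)
Lemma dvd_card_mult_set p (A : {set 'F_p}) d : prime p -> (d %| p.-1)%N ->
  (forall x : 'F_p, x != 0 -> x ^+ d = 1 -> is_multiplier A x) -> (d %| #|mult_set A|)%N.
Proof.
move=> p_pr d_dvd Hd; pose M := [set u : {unit 'F_p} | val u \in mult_set A].
have inM u : (u \in M) = (val u \in mult_set A) by rewrite in_set.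
have gM : group_set M.
  apply/group_setP; split=> [|u v]; rewrite !inM.
    by apply/multiplierP; apply: is_multiplier1.
  move=> /multiplierP u_mult /multiplierP v_mult; apply/multiplierP.
  by apply: is_multiplierM.
have -> : #|mult_set A| = #|Group gM|.
  rewrite -[RHS](card_imset _ val_inj); apply: eq_card => x; apply/idP/imsetP.
    move=> xM; have x0 : x \is a GRing.unit.
      by rewrite unitfE; case/multiplierP: xM.
    by exists (FinRing.unit 'F_p x0); rewrite ?inM.
  by move=> [u]; rewrite inM => uM ->.
have [w wE] := cyclicP (field_unit_group_cyclic [set: {unit 'F_p}]%G).
have w_ord : #[w]%g = p.-1 by rewrite orderE -wE card_finField_unit card_Fp.
have p1 : (0 < p.-1)%N by rewrite -ltnS prednK ?prime_gt1 ?prime_gt0.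
pose x := (w ^+ (p.-1 %/ d))%g.
have x_ord : #[x]%g = d.
  rewrite orderXdiv w_ord; last by rewrite dvdn_div.
  have /dvdnP[c cE] := d_dvd.
  have /andP[c_gt0 d_gt0] : (0 < c)%N && (0 < d)%N by rewrite -muln_gt0 -cE.
  by rewrite cE mulnK // mulKn.
rewrite -x_ord orderE; apply: cardSg; rewrite cycle_subG inM.
apply/multiplierP/Hd; first by rewrite -unitfE; apply: (valP x).
by rewrite -FinRing.val_unitX -x_ord expg_order.
Qed.

Theorem theorem3 (p : nat) (A : {set 'F_p}) :
  prime p -> diff_exact A (QR p) ->
  (forall x : 'F_p, x != 0 -> x ^+ Gp p = 1 -> is_multiplier A x) /\
  (Gp p %| #|mult_set A|)%N.
Proof.
move=> p_pr diffA; have [e [e0 eD e_inj e_Aint e_aut]] := additive_character p_pr.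
have m0 := diff_m_gt0 p_pr diffA e0 eD.
suff Hx : forall x : 'F_p, x != 0 -> x ^+ Gp p = 1 -> is_multiplier A x.
  by split=> //; apply: dvd_card_mult_set p_pr (Gp_dvd_predp p_pr m0) Hx.
move=> x x0 xG.
apply: (multiplier_of_powers p_pr diffA e0 eD e_inj e_Aint e_aut x0) => [q q_pr q_dvd|m1].
  have [|q_prim _] := @ordp_primitive p q p_pr.
    by rewrite prime_gt0 //=; have := dvdn_leq m0 q_dvd; have := prime_gt0 p_pr; lia.
  (* G_p divides the order of q, so x is a root of unity of that order and hence a power of q. *)
  have /dvdnP[c cE] := Gp_dvd_ordp q_pr q_dvd m0.
  have xo : x ^+ ordp p q = 1 by rewrite cE mulnC exprM xG expr1n.
  by have [j ->] := prim_rootP q_prim xo; exists j.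
by move: xG; rewrite /Gp m1 expr1.
Qed.
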